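(* Let $\mathsf k$ be a field of characteristic $0$ and $n\ge1$. There exists an isomorphism of complexes of $S_{n+1}$-representations over $\mathsf k$ $$\mathcal{M}as^\bullet\ \xrightarrow{\ \sim\ }\ \Phi^\bullet(\mathcal Q).$$
   Context: Write $[n]=\{1,\dots,n\}$, $\overline I=[n]\setminus I$. The complex $\mathcal{M}as^\bullet$. A type is a (possibly empty) sequence $\chi=(\chi_1<\dots<\chi_p)$ of elements of $[n]$; $|\chi|=p$ is its length. A flag of type $\chi$ is a chain of subsets $I_1\subset\dots\subset I_p\subset[n+1]$ with $|I_i|=\chi_i$; let $F\ell_\chi$ be the set of these, with its natural $S_{n+1}$-action ($F\ell_\emptyset$ is one point), and $M_\chi$ the $S_{n+1}$-representation of all functions $F\ell_\chi\to\mathsf k$. For types $\theta\subset\chi$ (as sets) let $\partial_{\chi\theta}:F\ell_\chi\to F\ell_\theta$ be the map forgetting the members of the flag not in type $\theta$, and let $i_{\chi\theta}:M_\chi\to M_\theta$ be the pushforward $i_{\chi\theta}(f)(I_\bullet)=\sum_{J_\bullet\in\partial_{\chi\theta}^{-1}(I_\bullet)}f(J_\bullet)$. For $|\chi|=p$ and $1\le i\le p$ let $\partial_i\chi$ be $\chi$ with $\chi_i$ omitted. Then $$\mathcal{M}as^\bullet:\ 0\to M_{\chi_0}\to\bigoplus_{|\chi|=n-1}M_\chi\to\dots\to\bigoplus_{|\chi|=1}M_\chi\to M_\emptyset\to0,\qquad \chi_0=(1,2,\dots,n),$$ in degrees $0,\dots,n$, where the only nonzero matrix entries of the differential are $d_{\chi,\partial_i\chi}=(-1)^i\,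 i_{\chi,\partial_i\chi}$. The complex $\Phi^\bullet(\mathcal Q)$. Let $s_i=(i\ i{+}1)\in S_{n+1}$; for $I\subset[n]$ let $W_I=\langle s_i:i\in I\rangle$, $a_I=\sum_{w\in W_I}w$, $b_I=\sum_{w\in W_I}\mathrm{sgn}(w)w$, and $R_I=\mathsf k[S_{n+1}]\,b_Ia_{\overline I}$ (the ribbon module, a left ideal of $\mathsf k[S_{n+1}]$). $\mathcal Q$ is the hyperbolic sheaf on the coordinate arrangement in $\mathbb R^n$ whose stalks at the positive cells $C_I=\{x: x_i=0\ (i\in I),\ x_j>0\ (j\notin I)\}$ are $\mathcal Q(I)=\bigoplus_{J\subset I}R_J$, and whose generalization maps $\gamma:\mathcal Q(I)\to\mathcal Q(I')$ for $I'\subset I$ are the natural projections onto direct summands. $\Phi^\bullet(\mathcal Q)$ is the complex in degrees $0,\dots,n$ with degree $i$ term $\bigoplus_{|I|=n-i}\mathcal Q(I)$, whose differential has, for $J=I\sqcup\{j\}$, component $(-1)^s\gamma:\mathcal Q(J)\to\mathcal Q(I)$ with $s=|\{i\in I: i<j\}|$, and all other components zero. *)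

(* Defs.v *)
From HB Require Import structures.
From mathcomp Require Import all_boot all_fingroup all_algebra.

Set Implicit Arguments.
Unset Strict Implicit.
Unset Printing Implicit Defensive.

Import GRing.Theory.
Local Open Scope ring_scope.

Section Linear.
Variables (k : fieldType) (U V : lmodType k) (f : U -> V) (fL : linear f).

Definition mk_linear : {linear U -> V} :=
  HB.pack f (GRing.isLinear.Build k U V _ f fL).

End Linear.

(* [s * t] in MathComp means "first s, then t"; everything below uses the
   functional convention [scomp s t] = s o t, for which the natural action on
   points, subsets and flags is a left action. *)
Definition scomp m (s t : 'S_m) : 'S_m := (t * s)%g.

Section Rep.
Variables (k : fieldType) (m : nat).

Record rep := Rep {
  rep_mod :> lmodType k;
  rep_act : 'S_m -> {linear rep_mod -> rep_mod};
  rep_act1 : forall v, rep_act 1%g v = v;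
  rep_actM : forall s t v, rep_act (scomp s t) v = rep_act s (rep_act t v)
}.

Record rep_hom (V W : rep) := RepHom {
  rep_hom_fun :> {linear V -> W};
  rep_hom_act : forall s v,
    rep_hom_fun (rep_act V s v) = rep_act W s (rep_hom_fun v)
}.

(* Cochain complexes in nonnegative degrees. *)
Record rep_complex := RepComplex {
  cx_term :> nat -> rep;
  cx_d : forall i, rep_hom (cx_term i) (cx_term i.+1);
  cx_dd : forall i x, cx_d i.+1 (cx_d i x) = 0
}.

Definition complex_iso (C D : rep_complex) : Prop :=
  exists f : forall i, rep_hom (C i) (D i),
    (forall i, bijective (f i)) /\
    (forall i (x : C i), f i.+1 (cx_d C i x) = cx_d D i (f i x)).

Section DirectSum.
Variables (T : finType) (P : pred T) (V : T -> rep).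

Definition dsum_mod : Type := {dffun forall t : {t : T | P t}, V (val t)}.

Definition dmk (f : forall t : {t : T | P t}, V (val t)) : dsum_mod :=
  finfun f.

HB.instance Definition _ := Choice.on dsum_mod.

Implicit Types x y z : dsum_mod.

Let dadd x y := dmk (fun t => x t + y t).
Let dopp x := dmk (fun t => - x t).
Let dscale a x := dmk (fun t => a *: x t).
Let dzero := dmk (fun=> 0).

Fact daddA : associative dadd.
Proof. by move=> x y z; apply/ffunP=> t; rewrite !ffunE addrA. Qed.
Fact daddC : commutative dadd.
Proof. by move=> x y; apply/ffunP=> t; rewrite !ffunE addrC. Qed.
Fact dadd0 : left_id dzero dadd.
Proof. by move=> x; apply/ffunP=> t; rewrite !ffunE add0r. Qed.
Fact daddN : left_inverse dzero dopp dadd.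
Proof. by move=> x; apply/ffunP=> t; rewrite !ffunE addNr. Qed.

HB.instance Definition _ :=
  GRing.isZmodule.Build dsum_mod daddA daddC dadd0 daddN.

Fact dscaleA a b x : dscale a (dscale b x) = dscale (a * b) x.
Proof. by apply/ffunP=> t; rewrite !ffunE scalerA. Qed.
Fact dscale1 : left_id 1 dscale.
Proof. by move=> x; apply/ffunP=> t; rewrite !ffunE scale1r. Qed.
Fact dscaleDr : right_distributive dscale +%R.
Proof. by move=> a x y; apply/ffunP=> t; rewrite !ffunE scalerDr. Qed.
Fact dscaleDl x : {morph dscale^~ x : a b / a + b}.
Proof. by move=> a b; apply/ffunP=> t; rewrite !ffunE scalerDl. Qed.

HB.instance Definition _ :=
  GRing.Zmodule_isLmodule.Build k dsum_mod dscaleA dscale1 dscaleDr dscaleDl.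

Definition dsum_act s x : dsum_mod := dmk (fun t => rep_act (V (val t)) s (x t)).

Fact dsum_act_linear s : linear (dsum_act s).
Proof. by move=> a x y; apply/ffunP=> t; rewrite !ffunE linearP. Qed.
Fact dsum_act1 x : mk_linear (dsum_act_linear 1%g) x = x.
Proof. by apply/ffunP=> t; rewrite !ffunE rep_act1. Qed.
Fact dsum_actM s t x : mk_linear (dsum_act_linear (scomp s t)) x =
  mk_linear (dsum_act_linear s) (mk_linear (dsum_act_linear t) x).
Proof. by apply/ffunP=> u; rewrite !ffunE rep_actM. Qed.

(* The direct sum of the [V t] over the indices [t] satisfying [P]. *)
Definition dsum : rep := Rep dsum_act1 dsum_actM.

(* The component of [x] at [t], which is 0 if [t] does not satisfy [P]. *)
Definition dcomp (x : dsum) (t : T) : V t :=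
  match @idP (P t) with
  | ReflectT Pt => (x : dsum_mod) (exist _ t Pt)
  | ReflectF _ => 0
  end.

Lemma dcompE (x : dsum) t (Pt : P t) :
  dcomp x t = (x : dsum_mod) (exist _ t Pt).
Proof.
rewrite /dcomp; case: {-}_ / idP => [Pt' | /(_ Pt) //].
by rewrite (bool_irrelevance Pt Pt').
Qed.

Lemma dcomp0 (x : dsum) t : ~~ P t -> dcomp x t = 0.
Proof. by rewrite /dcomp; case: {-}_ / idP => // Pt /negP[]. Qed.

Lemma dcomp_linear t : linear (dcomp^~ t).
Proof.
move=> a x y; have [Pt | nPt] := boolP (P t); last first.
  by rewrite !dcomp0 // scaler0 addr0.
by rewrite !(dcompE _ Pt) !ffunE.
Qed.

Lemma dcomp_act s (x : dsum) t :
  dcomp (rep_act dsum s x) t = rep_act (V t) s (dcomp x t).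
Proof.
have [Pt | nPt] := boolP (P t); last by rewrite !dcomp0 // linear0.
by rewrite !(dcompE _ Pt) ffunE.
Qed.

End DirectSum.
End Rep.

Arguments dcomp {k m T P V} x t.

(* [n] = {1, ..., n} is modelled by 'I_n, with i : 'I_n standing for i.+1. *)
Section Cube.
Variables (k : fieldType) (m n : nat).

(* A diagram of representations on the cube of subsets of [n]; the map
   [cube_map J I] is only meaningful (and only used) for I \subset J. *)
Record cube := Cube {
  cube_rep :> {set 'I_n} -> rep k m;
  cube_map : forall J I, rep_hom (cube_rep J) (cube_rep I);
  cube_mapM : forall J I K : {set 'I_n}, K \subset I -> I \subset J ->
    forall x, cube_map I K (cube_map J I x) = cube_map J K x
}.

Variables (V : cube) (eps : {set 'I_n} -> 'I_n -> k).

Definition sign_rule := forall (I : {set 'I_n}) (i j : 'I_n),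
  i \notin I -> j \notin I -> i != j ->
  eps I i * eps (i |: I) j = - (eps I j * eps (j |: I) i).

Hypothesis epsP : sign_rule.

(* Vanishes for i > n. *)
Definition cube_term (i : nat) : rep k m :=
  dsum (fun I : {set 'I_n} => #|I| + i == n)%N V.

(* The component from [j |: I] to [I], for j \notin I, is the structure map
   of the cube multiplied by the sign [eps I j]. *)
Definition cube_d i (x : cube_term i) : cube_term i.+1 :=
  dmk (fun I : {I : {set 'I_n} | (#|I| + i.+1 == n)%N} => \sum_(j | j \notin val I)
    eps (val I) j *: cube_map V (j |: val I) (val I) (dcomp x (j |: val I))).

Fact cube_d_linear i : linear (@cube_d i).
Proof.
move=> a x y; apply/ffunP=> I; rewrite !ffunE scaler_sumr -big_split /=.
apply: eq_bigr => j _.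
by rewrite dcomp_linear linearP scalerDr !scalerA mulrC.
Qed.

Fact cube_d_act i s x :
  mk_linear (@cube_d_linear i) (rep_act _ s x) =
  rep_act _ s (mk_linear (@cube_d_linear i) x).
Proof.
apply/ffunP=> I; rewrite !ffunE linear_sum; apply: eq_bigr => j _.
by rewrite dcomp_act rep_hom_act linearZ.
Qed.

Definition cube_diff i : rep_hom (cube_term i) (cube_term i.+1) :=
  RepHom (@cube_d_act i).

Fact cube_dd i x : cube_diff i.+1 (cube_diff i x) = 0.
Proof.
apply/ffunP=> -[I cI]; rewrite !ffunE /=.
pose T A := cube_map V A I (dcomp x A).
pose F j l := (eps I j * eps (j |: I) l) *: T (l |: (j |: I)).
transitivity (\sum_(j | j \notin I) \sum_(l | (l \notin I) && (l != j)) F j l).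
  apply: eq_bigr => j jI.
  have cJ : (#|j |: I| + i.+1 == n)%N.
    rewrite cardsU1 jI /= add1n addSn -addnS; exact: cI.
  rewrite (dcompE _ cJ) ffunE linear_sum scaler_sumr /=; apply: eq_big => l.
    by rewrite in_setU1 negb_or andbC.
  by move=> _; rewrite linearZ scalerA cube_mapM // subsetUr.
have FN j l : j \notin I -> l \notin I -> l != j -> F j l = - F l j.
  move=> jI lI lj; rewrite /F epsP // 1?eq_sym //.
  by rewrite scaleNr setUCA.
rewrite (eq_bigr (fun j : 'I_n => \sum_(l : 'I_n | (l \notin I) && (l < j)%N) F j l +
          \sum_(l : 'I_n | (l \notin I) && (j < l)%N) F j l)); last first.
  move=> j jI; rewrite (bigID (fun l : 'I_n => l < j)%N) /=.
  congr (_ + _); apply: eq_bigl => l; rewrite -val_eqE /=.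
    by case: ltngtP; rewrite ?andbT ?andbF.
  by case: ltngtP; rewrite ?andbT ?andbF.
rewrite big_split /= [X in _ + X](exchange_big_dep (fun l => l \notin I)) /=;
  last by move=> j l _ /andP[].
rewrite -big_split big1 //= => j jI.
rewrite [X in _ + X](eq_bigl (fun l : 'I_n => (l \notin I) && (l < j)%N));
  last by move=> l; rewrite jI.
rewrite -big_split big1 //= => l /andP[lI lj].
by rewrite FN ?addNr // neq_ltn lj.
Qed.

Definition cube_complex : rep_complex k m := RepComplex cube_dd.

End Cube.

Lemma card_lt_setU1 n (A : {set 'I_n}) (c d : 'I_n) : c \notin A ->
  #|[set e in c |: A | (e < d)%N]| = ((c < d) + #|[set e in A | (e < d)%N]|)%N.
Proof.
move=> cA.
have [cd | cd] := boolP (c < d)%N.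
  have -> : [set e in c |: A | (e < d)%N] = c |: [set e in A | (e < d)%N].
    by apply/setP=> e; rewrite !inE; case: (eqVneq e c) => [-> | ].
  by rewrite cardsU1 !inE (negbTE cA).
congr #|pred_of_set _|; apply/setP=> e; rewrite !inE.
by case: (eqVneq e c) => [-> | //]; rewrite (negbTE cd) !andbF.
Qed.

Section Mas.
Variables (k : fieldType) (n : nat).

Implicit Types chi theta eta : {set 'I_n}.

(* A type is the set of its members.  A flag of type chi is stored as
   a function on 'I_n: F c is the member of cardinality c.+1 when c is in chi,
   and F c is empty when c is not in chi. *)
Definition is_flag chi (F : {ffun 'I_n -> {set 'I_n.+1}}) : bool :=
  [forall c, #|F c| == (if c \in chi then c.+1 else 0)%N] &&
  [forall c in chi, forall d in chi, (c <= d)%N ==> (F c \subset F d)].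

Definition flag chi : Type := {F | is_flag chi F}.
HB.instance Definition _ chi := Finite.on (flag chi).

Fact flag_act_subproof (s : 'S_n.+1) chi (F : flag chi) :
  is_flag chi [ffun c => s @: val F c].
Proof.
case: F => F /= /andP[/forallP F1 /forall_inP F2].
apply/andP; split.
  by apply/forallP=> c; rewrite ffunE (card_imset _ (@perm_inj _ s)).
apply/forall_inP=> c cc; apply/forall_inP=> d dc; apply/implyP=> cd.
rewrite !ffunE imsetS //.
by have /forall_inP/(_ d dc)/implyP := F2 c cc; apply.
Qed.

Definition flag_act (s : 'S_n.+1) chi (F : flag chi) : flag chi :=
  exist (fun G => is_flag chi G) _ (flag_act_subproof s F).

Lemma flag_act1 chi (F : flag chi) : flag_act 1%g F = F.
Proof.
apply/val_inj/ffunP=> c; rewrite ffunE -[RHS]imset_id.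
by apply: eq_imset => x; rewrite perm1.
Qed.

Lemma flag_actM s t chi (F : flag chi) :
  flag_act (scomp s t) F = flag_act s (flag_act t F).
Proof.
apply/val_inj/ffunP=> c; rewrite !ffunE -imset_comp.
by apply: eq_imset => x; rewrite permM.
Qed.

Definition Mmod chi : lmodType k := {ffun flag chi -> k^o}.

Definition M_act chi s (f : Mmod chi) : Mmod chi :=
  [ffun F => f (flag_act s^-1%g F)].

Fact M_act_linear chi s : linear (@M_act chi s).
Proof. by move=> a f g; apply/ffunP=> F; rewrite !ffunE. Qed.
Fact M_act1 chi (f : Mmod chi) : mk_linear (M_act_linear 1%g) f = f.
Proof. by apply/ffunP=> F; rewrite !ffunE invg1 flag_act1. Qed.
Fact M_actM chi s t (f : Mmod chi) : mk_linear (M_act_linear (scomp s t)) f =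
  mk_linear (M_act_linear s) (mk_linear (M_act_linear t) f).
Proof.
apply/ffunP=> F; rewrite !ffunE -flag_actM; congr (f (flag_act _ F)).
by rewrite /scomp invMg.
Qed.

Definition M_ chi : rep k n.+1 := Rep (@M_act1 chi) (@M_actM chi).

Definition forget theta (F : {ffun 'I_n -> {set 'I_n.+1}}) :
    {ffun 'I_n -> {set 'I_n.+1}} :=
  [ffun c => if c \in theta then F c else set0].

Lemma forget_flag chi theta (F : flag chi) :
  theta \subset chi -> is_flag theta (forget theta (val F)).
Proof.
case: F => F /= /andP[/forallP F1 /forall_inP F2] /subsetP tc.
apply/andP; split.
  apply/forallP=> c; rewrite ffunE; have := F1 c; have := tc c.
  by case: (c \in theta) => [/(_ isT) -> // | _ _]; rewrite cards0.
apply/forall_inP=> c cc; apply/forall_inP=> d dc; apply/implyP=> cd.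
rewrite !ffunE cc dc.
by have /forall_inP/(_ d (tc _ dc))/implyP := F2 c (tc _ cc); apply.
Qed.

Lemma forget_act theta s chi (F : flag chi) :
  forget theta (val (flag_act s F)) =
  [ffun c => s @: (forget theta (val F) c)].
Proof.
by apply/ffunP=> c; rewrite !ffunE; case: ifP => // _; rewrite imset0.
Qed.

Definition i_fun chi theta (f : Mmod chi) : Mmod theta :=
  [ffun F : flag theta =>
     \sum_(J : flag chi | forget theta (val J) == val F) f J].

Fact i_linear chi theta : linear (@i_fun chi theta).
Proof.
move=> a f g; apply/ffunP=> F; rewrite !ffunE scaler_sumr -big_split /=.
by apply: eq_bigr => J _; rewrite !ffunE.
Qed.

Fact i_act chi theta s (f : M_ chi) :
  mk_linear (@i_linear chi theta) (rep_act (M_ chi) s f) =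
  rep_act (M_ theta) s (mk_linear (@i_linear chi theta) f).
Proof.
apply/ffunP=> F; rewrite !ffunE.
have actK (eta : {set 'I_n}) :
    cancel (@flag_act s eta) (@flag_act s^-1%g eta).
  by move=> G; rewrite -flag_actM /scomp mulgV flag_act1.
have actVK (eta : {set 'I_n}) :
    cancel (@flag_act s^-1%g eta) (@flag_act s eta).
  by move=> G; rewrite -flag_actM /scomp mulVg flag_act1.
rewrite (reindex (@flag_act s chi)) /=; last first.
  by exists (@flag_act s^-1%g chi) => G _; rewrite ?actK ?actVK.
apply: eq_big => [J | J _]; last by rewrite ffunE actK.
rewrite -{1}[F](actVK theta) forget_act /=.
apply/eqP/eqP => [/ffunP E | E]; apply/ffunP=> c.
  by have := E c; rewrite [LHS]ffunE [RHS]ffunE => /(imset_inj (@perm_inj _ s)).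
by rewrite [LHS]ffunE [RHS]ffunE E.
Qed.

Definition i_ chi theta : rep_hom (M_ chi) (M_ theta) :=
  @RepHom k n.+1 (M_ chi) (M_ theta) _ (@i_act chi theta).

Fact i_comp chi theta eta : eta \subset theta -> theta \subset chi ->
  forall f, i_ theta eta (i_ chi theta f) = i_ chi eta f.
Proof.
move=> et tc f; apply/ffunP=> F; rewrite !ffunE /=.
under eq_bigr do rewrite ffunE.
pose p (J : flag chi) : flag theta :=
  exist (fun G => is_flag theta G) _ (forget_flag J tc).
have pE (J : flag chi) : forget eta (val (p J)) = forget eta (val J).
  apply/ffunP=> c; rewrite !ffunE; case: ifP => // ce.
  by rewrite (subsetP et).
rewrite [RHS](partition_big p
  (fun G : flag theta => forget eta (val G) == val F)) /=; last first.
  by move=> J; rewrite -pE.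
apply: eq_bigr => G /eqP GF; apply: eq_bigl => J.
apply/eqP/andP => [E | [_ /eqP <-] //].
have pJ : p J = G by apply/val_inj.
by split; apply/eqP; rewrite // -pE pJ.
Qed.

Definition M_cube : cube k n.+1 n := Cube i_comp.

(* For theta = chi minus c, the 1-based position i of c in chi is
   |{d in chi : d <= c}|, and the sign is (-1)^i. *)
Definition Mas_sign theta (c : 'I_n) : k :=
  (-1) ^+ #|[set d in c |: theta | (d <= c)%N]|.

Fact Mas_sign_rule : sign_rule Mas_sign.
Proof.
have E (A : {set 'I_n}) (c : 'I_n) : c \notin A ->
    Mas_sign A c = - (-1) ^+ #|[set d in A | (d < c)%N]|.
  move=> cA; rewrite /Mas_sign.
  have -> : [set d in c |: A | (d <= c)%N] = c |: [set d in A | (d < c)%N].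
    apply/setP=> d; rewrite !inE leq_eqVlt val_eqE.
    by case: (eqVneq d c) => [-> | dc] //=; rewrite ?eqxx ?leqnn.
  by rewrite cardsU1 !inE (negbTE cA) /= exprS mulN1r.
move=> A i j iA jA ij.
rewrite !E ?inE ?negb_or ?iA ?jA ?andbT // 1?eq_sym // !card_lt_setU1 // !mulrNN !exprD.
have : i != j :> nat by [].
by case: ltngtP => // _ _; rewrite expr0 expr1 !mul1r !(mulN1r, mulrN) ?opprK mulrC.
Qed.

Definition Mas : rep_complex k n.+1 := cube_complex M_cube Mas_sign_rule.

End Mas.

Section Phi.
Variables (k : fieldType) (n : nat).

Local Notation S := 'S_n.+1.

(* The underlying space of the group algebra k[S_{n+1}]; its product is
   [gmul] and not the pointwise product. *)
Definition galg : vectType k := {ffun S -> k^o}.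

Definition gmul (x y : galg) : galg :=
  [ffun g => \sum_(p : S * S | scomp p.1 p.2 == g) (x p.1 : k) * y p.2].

Definition gelt (s : S) : galg := [ffun g => (g == s)%:R].

Lemma gmulE x y g : gmul x y g = \sum_h (x h : k) * y (scomp h^-1%g g).
Proof.
rewrite ffunE.
rewrite (reindex (fun h : S => (h, scomp h^-1%g g))) /=; last first.
  exists fst => [h _ //| [h l] /=]; rewrite inE /= => /eqP <-.
  by rewrite /scomp mulgK.
by apply: eq_bigl => h; rewrite /scomp mulgKV eqxx.
Qed.

Lemma gmulA : associative gmul.
Proof.
move=> x y z; apply/ffunP=> g; rewrite !gmulE.
under [RHS]eq_bigr do rewrite gmulE mulr_suml.
rewrite exchange_big /=; apply: eq_bigr => h _.
rewrite gmulE mulr_sumr (reindex (fun l => scomp h^-1%g l)) /=; last first.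
  exists (fun l => scomp h l) => l _; rewrite /scomp.
    by rewrite mulgKV.
  by rewrite mulgK.
apply: eq_bigr => l _; rewrite mulrA; congr (_ * z _).
by rewrite /scomp invMg invgK !mulgA mulgKV.
Qed.

Lemma gmul1 : left_id (gelt 1%g) gmul.
Proof.
move=> x; apply/ffunP=> g; rewrite gmulE (bigD1 1%g) //= big1 => [|h h1].
  by rewrite ffunE eqxx mul1r addr0 /scomp invg1 mulg1.
by rewrite ffunE (negbTE h1) mul0r.
Qed.

Lemma geltM s t : gelt (scomp s t) = gmul (gelt s) (gelt t).
Proof.
apply/ffunP=> g; rewrite gmulE (bigD1 s) //= big1 => [|h hs].
  rewrite !ffunE eqxx mul1r addr0; congr ((_ : bool)%:R).
  by rewrite /scomp; apply/eqP/eqP => [-> | <-]; rewrite ?mulgK ?mulgKV.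
by rewrite ffunE (negbTE hs) mul0r.
Qed.

Lemma gmul_linearl y : linear (gmul^~ y).
Proof.
move=> a x x'; apply/ffunP=> g; rewrite [RHS]ffunE [in RHS]ffunE !gmulE.
rewrite scaler_sumr -big_split; apply: eq_bigr => h _ /=.
by rewrite !ffunE mulrDl scalerAl.
Qed.

Lemma gmul_linearr x : linear (gmul x).
Proof.
move=> a y y'; apply/ffunP=> g; rewrite [RHS]ffunE [in RHS]ffunE !gmulE.
rewrite scaler_sumr -big_split; apply: eq_bigr => h _ /=.
by rewrite !ffunE mulrDr scalerAr.
Qed.

Implicit Types I J K : {set 'I_n}.

Definition s_ (i : 'I_n) : S := tperm (inord i) (inord i.+1).

Definition W_ I : {group S} := <<[set s_ i | i in I]>>%G.

Definition a_ I : galg := \sum_(w in W_ I) gelt w.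

Definition b_ I : galg := \sum_(w in W_ I) (-1) ^+ odd_perm w *: gelt w.

Definition ribbon I : {vspace galg} :=
  limg (linfun (mk_linear (gmul_linearl (gmul (b_ I) (a_ (~: I)))))).

Lemma ribbonP I x :
  reflect (exists y, x = gmul y (gmul (b_ I) (a_ (~: I)))) (x \in ribbon I).
Proof.
apply: (iffP memv_imgP) => [[y _ ->] | [y ->]]; exists y; rewrite ?memvf //;
  by rewrite lfunE.
Qed.

Lemma ribbon_left_ideal I x y : y \in ribbon I -> gmul x y \in ribbon I.
Proof.
by case/ribbonP=> z ->; apply/ribbonP; exists (gmul x z); rewrite gmulA.
Qed.

Definition R_mod I : lmodType k := subvs_of (ribbon I).

Definition R_act I s (x : R_mod I) : R_mod I :=
  Subvs (ribbon_left_ideal (gelt s) (subvsP x)).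

Fact R_act_linear I s : linear (@R_act I s).
Proof. by move=> a x y; apply: val_inj; apply: gmul_linearr. Qed.
Fact R_act1 I (x : R_mod I) : mk_linear (R_act_linear 1%g) x = x.
Proof. by apply: val_inj; rewrite /= gmul1. Qed.
Fact R_actM I s t (x : R_mod I) : mk_linear (R_act_linear (scomp s t)) x =
  mk_linear (R_act_linear s) (mk_linear (R_act_linear t) x).
Proof. by apply: val_inj; rewrite /= geltM gmulA. Qed.

Definition R_ I : rep k n.+1 := Rep (@R_act1 I) (@R_actM I).

Definition Q_ I : rep k n.+1 := dsum (fun J => J \subset I) R_.

(* Since [dcomp x K] is x_K for K \subset J, this is the projection
   of Q(J) onto the direct summand Q(I) when I \subset J. *)
Definition gamma_fun J I (x : Q_ J) : Q_ I :=
  dmk (fun K : {K : {set 'I_n} | K \subset I} => dcomp x (val K)).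

Fact gamma_linear J I : linear (@gamma_fun J I).
Proof. by move=> a x y; apply/ffunP=> K; rewrite !ffunE dcomp_linear. Qed.

Fact gamma_act J I s x : mk_linear (@gamma_linear J I) (rep_act (Q_ J) s x) =
  rep_act (Q_ I) s (mk_linear (@gamma_linear J I) x).
Proof. by apply/ffunP=> K; rewrite !ffunE dcomp_act. Qed.

Definition gamma J I : rep_hom (Q_ J) (Q_ I) := RepHom (@gamma_act J I).

Fact gamma_comp J I K : K \subset I -> I \subset J ->
  forall x, gamma I K (gamma J I x) = gamma J K x.
Proof.
move=> KI IJ x; apply/ffunP=> -[L LK].
by rewrite !ffunE /= (dcompE _ (subset_trans LK KI)) ffunE.
Qed.

Definition Q_cube : cube k n.+1 n := Cube gamma_comp.

Definition Phi_sign I (j : 'I_n) : k := (-1) ^+ #|[set i in I | (i < j)%N]|.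

Fact Phi_sign_rule : sign_rule Phi_sign.
Proof.
move=> A i j iA jA ij; rewrite /Phi_sign !card_lt_setU1 // !exprD.
have : i != j :> nat by [].
by case: ltngtP => // _ _; rewrite expr0 expr1 !mul1r !(mulN1r, mulrN) ?opprK mulrC.
Qed.

Definition PhiQ : rep_complex k n.+1 := cube_complex Q_cube Phi_sign_rule.

End Phi.

(* Main.v *)
(* M_chi embeds in k[S_(n+1)] by pulling a function on flags back along the orbit
   map of the standard flag, whose stabiliser is W_(~: chi).  Averaging over the
   group yields an equivariant projection of k[S_(n+1)] onto each ribbon module
   R_J.  The J-component (J \subset chi) of the isomorphism M_chi -> Q(chi) is the
   composite of the pushforward M_chi -> M_J, the embedding of M_J and the
   projection onto R_J; it commutes with the structure maps by construction.

   Surjectivity: the pushforward of z b_J along the orbit map has K-component the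
   projection of z b_J a_(~: K), which vanishes unless J \subset K and is
   z b_J a_(~: J) for K = J, so downward induction on J applies.

   Injectivity: write each flag as w applied to the standard flag with
   Des(w) \subset chi.  The elements w b_J a_(~: J), with J = Des(w), are linearly
   independent, the matrix of their coefficients being triangular with respect to
   \sum_p p * w(p).  This gives an injective map from M_chi to Q(chi), which by
   finiteness of the dimension forces every surjection to be injective.

   The sign conventions of the two complexes differ by a global -1. *)
From HB Require Import structures.
From mathcomp Require Import all_boot all_fingroup all_algebra zify.
Require Import Defs.

Set Implicit Arguments.
Unset Strict Implicit.
Unset Printing Implicit Defensive.

Import GRing.Theory.

(** * Ascending representatives of parabolic cosets, and descents of permutations *)

Section Perm.
Variable n : nat.
Local Notation S := 'S_n.+1.
Implicit Types (f : 'I_n.+1 -> nat) (g u v w : S) (K L : {set 'I_n}).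

Definition lo (i : 'I_n) : 'I_n.+1 := inord i.
Definition hi (i : 'I_n) : 'I_n.+1 := inord i.+1.

Lemma loE (i : 'I_n) : lo i = i :> nat.
Proof. by rewrite inordK // ltnW // ltnS. Qed.

Lemma hiE (i : 'I_n) : hi i = i.+1 :> nat.
Proof. by rewrite inordK // ltnS. Qed.

Lemma lo_neq_hi i : lo i != hi i.
Proof. by rewrite -val_eqE /= loE hiE neq_ltn ltnSn. Qed.

(** The ranking [f] is a parameter because three are needed: the value itself, its reversal [n - p]
    for descents, and a sorting key attached to a flag. *)
Definition ascending f K g : bool := [forall i in K, f (g (lo i)) < f (g (hi i))].

(* [(u * g)%g] is [g \o u], so that [u * g] for [u \in W_ K] runs through the
   coset [g W_K] of the functional convention of [scomp]. *)
Definition moment f g : nat := \sum_(p < n.+1) p * f (g p).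

(** The exchange moves the larger value one place to the right, so the moment grows by exactly the
    difference of the two values. *)
Lemma moment_swap f g (i : 'I_n) :
  f (g (hi i)) < f (g (lo i)) -> moment f g < moment f (s_ i * g)%g.
Proof.
move=> lt_f; rewrite /moment.
have hl : hi i != lo i by rewrite eq_sym lo_neq_hi.
rewrite (bigD1 (lo i)) //= [X in _ < X](bigD1 (lo i)) //=.
rewrite (bigD1 (hi i)) //= [X in _ < _ + X](bigD1 (hi i)) //=.
rewrite !permM /s_ tpermL tpermR.
rewrite (eq_bigr (fun p : 'I_n.+1 => p * f ((s_ i * g)%g p))) => [|p /andP[p1 p2]].
  rewrite -/(lo i) -/(hi i) loE hiE; set X := \sum_(_ | _) _; nia.
by rewrite permM /s_ tpermD // eq_sym.
Qed.

Lemma ascending_interval f K g (p q : 'I_n.+1) :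
  ascending f K g -> p < q ->
  (forall c : 'I_n, p <= c < q -> c \in K) -> f (g p) < f (g q).
Proof.
move=> /forall_inP asc_g; case: q => q q_lt /=.
elim: q q_lt => // q IHq q_lt; rewrite ltnS => le_pq K_pq.
have q_ltn : q < n by [].
have Kq : Ordinal q_ltn \in K by apply: K_pq; rewrite /= le_pq ltnSn.
have := asc_g _ Kq.
have -> : hi (Ordinal q_ltn) = Ordinal q_lt by apply: val_inj; rewrite /= hiE.
apply: leq_ltn_trans.
have [p_eq|lt_pq] := eqVneq (p : nat) q.
  by rewrite (_ : lo _ = p) //; apply: val_inj; rewrite /= loE.
have q_lt' : q < n.+1 by exact: ltnW.
rewrite (_ : lo _ = Ordinal q_lt'); last by apply: val_inj; rewrite /= loE.
apply: ltnW; apply: IHq => [|c /andP[pc cq]]; first by rewrite ltn_neqAle lt_pq.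
by apply: K_pq; rewrite pc ltnW.
Qed.

Lemma ascending_setT f g (p q : 'I_n.+1) :
  ascending f setT g -> (f (g p) < f (g q)) = (p < q).
Proof.
move=> asc_g; have mono (r s : 'I_n.+1) : r < s -> f (g r) < f (g s).
  by move=> rs; apply: (ascending_interval asc_g) => // c _; rewrite inE.
apply/idP/idP => [|/mono //]; apply: contraTT.
rewrite -!leqNgt leq_eqVlt => /orP[/eqP/val_inj -> // | /mono /ltnW //].
Qed.

(** A strictly monotone [h] satisfies [p <= h p]; this is applied to both [g] and its inverse. *)
Lemma ascending_id g : ascending val setT g -> g = 1%g.
Proof.
have ge (h : S) : {mono h : p q / (p < q)%N} -> forall p : 'I_n.+1, p <= h p.
  move=> mono_h [p p_lt]; elim: p p_lt => //= p IHp p_lt.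
  have p_lt' : p < n.+1 by exact: ltnW.
  by apply: leq_ltn_trans (IHp p_lt') _; rewrite mono_h /=.
move=> asc_g; apply/permP=> p; rewrite perm1; apply/val_inj/eqP.
rewrite eqn_leq ge; last by move=> r s; exact: ascending_setT.
rewrite andbT -{2}(permK g p); apply: (ge (g^-1)%g) => r s /=.
by rewrite -(ascending_setT _ _ asc_g) !permKV.
Qed.

(* The stabiliser of the standard flag of type [~: K]. *)
Definition cut_stab K : {set S} :=
  [set u : S | [forall c in ~: K, forall p : 'I_n.+1, (u p <= c) == (p <= c)]].

Lemma cut_stabP K u :
  reflect (forall (c : 'I_n) (p : 'I_n.+1), c \notin K -> (u p <= c) = (p <= c))
          (u \in cut_stab K).
Proof.
rewrite inE; apply: (iffP forall_inP) => [st c p cK | st c cK].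
  by have := st c; rewrite inE => /(_ cK)/forallP/(_ p)/eqP.
by apply/forallP=> p; rewrite st //; rewrite inE in cK.
Qed.

Fact cut_stab_group_set K : group_set (cut_stab K).
Proof.
apply/group_setP; split=> [|u v /cut_stabP st_u /cut_stabP st_v].
  by apply/cut_stabP=> c p _; rewrite perm1.
by apply/cut_stabP=> c p cK; rewrite permM st_v ?st_u.
Qed.
Canonical cut_stab_group K := Group (cut_stab_group_set K).

Lemma s_cut_stab K i : i \in K -> s_ i \in cut_stab K.
Proof.
move=> iK; apply/cut_stabP=> c p cK.
have ci : c != i :> nat by apply: contraNneq cK => /val_inj ->.
rewrite /s_ -/(lo i) -/(hi i); case: tpermP => [->|->|//]; rewrite loE hiE; lia.
Qed.

Lemma s_W K i : i \in K -> s_ i \in W_ K.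
Proof. by move=> iK; apply/mem_gen/imset_f. Qed.

Lemma W_sub_cut_stab K : W_ K \subset cut_stab K.
Proof.
by rewrite gen_subG; apply/subsetP=> _ /imsetP[i iK ->]; exact: s_cut_stab.
Qed.

Lemma moment_max_ascending f K g : injective f ->
  (forall u, u \in W_ K -> moment f (u * g)%g <= moment f g) -> ascending f K g.
Proof.
move=> f_inj max_g; apply/forall_inP=> i iK; rewrite ltnNge leq_eqVlt.
apply/norP; split; last first.
  by apply/negP=> /moment_swap; rewrite ltnNge max_g ?s_W.
by rewrite (inj_eq f_inj) (inj_eq perm_inj) eq_sym lo_neq_hi.
Qed.

Lemma exists_moment_max f K g : exists2 u, u \in W_ K &
  forall v, v \in W_ K -> moment f (v * g)%g <= moment f (u * g)%g.
Proof.
case: (@arg_maxnP _ 1%g (mem (W_ K)) (fun u => moment f (u * g)%g)) => [|u Wu max_u].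
  exact: group1.
by exists u.
Qed.

Lemma exists_ascending f K g : injective f ->
  exists2 u, u \in W_ K & ascending f K (u * g)%g.
Proof.
move=> f_inj; have [u Wu max_u] := exists_moment_max f K g; exists u => //.
by apply: moment_max_ascending => // v Wv; rewrite mulgA max_u ?groupM.
Qed.

(** If [u] is not 1, it reverses some adjacent pair [lo i], [hi i], and [i] lies in [K] because [u]
    respects the cuts outside [K]. Those cuts cannot separate the two images either, so [g]
    increases from [u (hi i)] to [u (lo i)], against [u * g] ascending at [i]. *)
Lemma ascending_uniq f K g u : injective f -> u \in cut_stab K ->
  ascending f K g -> ascending f K (u * g)%g -> u = 1%g.
Proof.
move=> f_inj /cut_stabP st_u asc_g /forall_inP asc_ug.
apply/ascending_id/forall_inP=> i _; rewrite ltnNge; apply/negP=> le_u.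
have {le_u} lt_u : u (hi i) < u (lo i).
  by rewrite ltn_neqAle le_u andbT val_eqE (inj_eq perm_inj) eq_sym lo_neq_hi.
have [iK|iK] := boolP (i \in K); last first.
  have := st_u i (lo i) iK; have := st_u i (hi i) iK.
  rewrite loE hiE leqnn ltnn; lia.
have := asc_ug _ iK; rewrite !permM ltnNge ltnW //.
apply: (ascending_interval asc_g) => // c /andP[le_c lt_c].
apply: contraTT lt_c => cK; rewrite -leqNgt st_u // loE.
by apply: ltnW; rewrite -hiE -st_u.
Qed.

(** Sorting [g] within its [W_ K]-coset gives an ascending element of [cut_stab K]; the identity is
    also ascending, so by uniqueness the sorted element is 1. *)
Lemma cut_stab_W K : cut_stab K = W_ K.
Proof.
apply/eqP; rewrite eqEsubset W_sub_cut_stab andbT; apply/subsetP=> g st_g.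
have [u Wu asc_ug] := exists_ascending K g (@val_inj _ _ 'I_n.+1).
have st_ug : (u * g)%g \in cut_stab K.
  by rewrite groupM // (subsetP (W_sub_cut_stab K)).
have ug1 : (u * g)%g = 1%g.
  apply: (ascending_uniq (g := 1%g) (@val_inj _ _ 'I_n.+1) st_ug); last by rewrite mulg1.
  by apply/forall_inP=> i _; rewrite !perm1 /= loE hiE.
by rewrite -(mulKg u g) ug1 mulg1 groupV.
Qed.

(** A maximiser of the moment on the coset is ascending, and [ascending_uniq] leaves only one
    ascending element there. *)
Lemma ascending_moment_max f K g u : injective f -> ascending f K g -> u \in W_ K ->
  moment f (u * g)%g <= moment f g ?= iff (u == 1%g).
Proof.
move=> f_inj asc_g Wu.
have uniq v : v \in W_ K -> ascending f K (v * g)%g -> v = 1%g.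
  by move=> Wv; apply: ascending_uniq; rewrite ?cut_stab_W.
have max_g v : v \in W_ K -> moment f (v * g)%g <= moment f g.
  have [w Ww max_w] := exists_moment_max f K g; move=> Wv.
  suff w1 : w = 1%g by have := max_w v Wv; rewrite w1 mul1g.
  apply: uniq => //; apply: moment_max_ascending => // w' Ww'.
  by rewrite mulgA max_w ?groupM.
split; first exact: max_g.
apply/eqP/eqP=> [eq_m | ->]; last by rewrite mul1g.
apply: uniq => //; apply: moment_max_ascending => // v Wv.
by rewrite mulgA eq_m max_g ?groupM.
Qed.

Definition des g : {set 'I_n} := [set i | g (hi i) < g (lo i)].

Lemma ascending_des g : ascending val (~: des g) g.
Proof.
apply/forall_inP=> i; rewrite !inE -leqNgt leq_eqVlt val_eqE (inj_eq perm_inj).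
by rewrite (negbTE (lo_neq_hi i)).
Qed.

Lemma descending_des g : ascending (fun p : 'I_n.+1 => n - p) (des g) g.
Proof.
apply/forall_inP=> i; rewrite inE => lt_g.
have := ltn_ord (g (lo i)); lia.
Qed.

Lemma moment_rev g :
  moment (fun p : 'I_n.+1 => n - p) g + moment val g = \sum_(p < n.+1) p * n.
Proof.
rewrite -big_split /=; apply: eq_bigr => p _; have := ltn_ord (g p); nia.
Qed.

(** Two inequalities are chained through [u * g]. For the reversed ranking [g] is ascending on its
    descents, so its ordinary moment is minimal among the [u * g]. For the ordinary ranking [h] is
    ascending off its descents, so its moment is maximal in its coset, which contains [u * g]. *)
Lemma moment_des_triangular g h u v : des g = des h ->
  u \in W_ (des g) -> v \in W_ (~: des g) -> h = (v * (u * g))%g ->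
  moment val g <= moment val h ?= iff (u == 1%g) && (v == 1%g).
Proof.
move=> eq_des Wu Wv hE.
have rev_inj : injective (fun p : 'I_n.+1 => n - p).
  by move=> p q; have := ltn_ord p; have := ltn_ord q => ? ? ?; apply: val_inj => /=; lia.
have [le1 eq1] := ascending_moment_max rev_inj (descending_des g) Wu.
have Wv' : (v^-1)%g \in W_ (~: des h) by rewrite groupV -eq_des.
have vh : (v^-1 * h)%g = (u * g)%g by rewrite hE mulKg.
have := ascending_moment_max (@val_inj _ _ 'I_n.+1) (ascending_des h) Wv'.
rewrite vh invg_eq1 => -[le2 eq2].
have rev := etrans (moment_rev g) (esym (moment_rev (u * g)%g)).
rewrite -eq1 -eq2; move: le1 le2 rev.
move: (moment _ (u * g)%g) (moment _ g) (moment \val (u * g)%g) (moment \val h).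
by move: (moment \val g) => a b c d e *; split; lia.
Qed.

End Perm.

(** * Flags as the orbit of the standard flag *)

Lemma card_ord_lt m k : k <= m -> #|[set p : 'I_m | p < k]| = k.
Proof.
move=> km; have -> : [set p : 'I_m | p < k] = [set widen_ord km q | q : 'I_k].
  apply/setP=> p; rewrite inE.
  apply/idP/imsetP=> [pk | [q _ ->]]; last exact: (ltn_ord q).
  by exists (Ordinal pk) => //; apply: val_inj.
by rewrite card_imset ?card_ord // => q r /(congr1 val)/= /val_inj.
Qed.

Section Flags.
Variable n : nat.
Local Notation S := 'S_n.+1.
Implicit Types (g u v w : S) (chi theta K : {set 'I_n}).

Definition std_cut chi : {ffun 'I_n -> {set 'I_n.+1}} :=
  [ffun c : 'I_n => if c \in chi then [set p : 'I_n.+1 | p <= c] else set0].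

Fact std_flag_subproof chi : is_flag chi (std_cut chi).
Proof.
apply/andP; split.
  apply/forallP=> c; rewrite ffunE; case: ifP => _; last by rewrite cards0.
  have := @card_ord_lt n.+1 c.+1; rewrite ltnS ltnW // => /(_ isT) <-.
  by [].
apply/forall_inP=> c cc; apply/forall_inP=> d dc; apply/implyP=> cd.
rewrite !ffunE cc dc; apply/subsetP=> p; rewrite !inE => pc.
exact: leq_trans cd.
Qed.

Definition std_flag chi : flag chi :=
  exist (fun F => is_flag chi F) _ (std_flag_subproof chi).

Lemma flag_valE chi (F G : flag chi) :
  (forall c, c \in chi -> val F c = val G c) -> F = G.
Proof.
case: F G => F Ff [G Gf] /= eqFG; apply/val_inj/ffunP=> c /=.
have [/eqFG //|cc] := boolP (c \in chi).
case/andP: Ff => /forallP/(_ c) + _; case/andP: Gf => /forallP/(_ c) + _.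
by rewrite (negbTE cc) !cards_eq0 => /eqP -> /eqP ->.
Qed.

Lemma mem_act_std_flag g chi c p : c \in chi ->
  (g p \in val (flag_act g (std_flag chi)) c) = (p <= c).
Proof. by move=> cc; rewrite !ffunE cc mem_imset ?inE //; exact: perm_inj. Qed.

Lemma flag_act_std g chi :
  (flag_act g (std_flag chi) == std_flag chi) = (g \in W_ (~: chi)).
Proof.
rewrite -cut_stab_W; apply/eqP/cut_stabP=> [fix_g c p | st_g].
  rewrite inE negbK => cc; have := mem_act_std_flag g p cc.
  by rewrite fix_g ffunE cc inE.
apply: flag_valE => c cc; apply/setP=> q; rewrite -(permKV g q).
by rewrite mem_act_std_flag // ffunE cc inE st_g // inE negbK.
Qed.

Lemma flag_act_std_eq g h chi :
  (flag_act g (std_flag chi) == flag_act h (std_flag chi)) =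
  (scomp h^-1 g \in W_ (~: chi))%g.
Proof.
rewrite -flag_act_std flag_actM; apply/eqP/eqP=> [-> | E].
  by rewrite -flag_actM /scomp mulgV flag_act1.
rewrite -[in RHS]E -flag_actM.
by rewrite /scomp mulVg flag_act1.
Qed.

Lemma flag_mono chi (F : flag chi) c d :
  c \in chi -> d \in chi -> c <= d -> val F c \subset val F d.
Proof.
case: F => F /= /andP[_ /forall_inP mono_F] cc dc cd.
by have /forall_inP/(_ d dc)/implyP := mono_F c cc; apply.
Qed.

(* The representative is found by sorting [0, n] by [key]: first by depth in
   the flag, then by value. *)
Lemma flag_repr chi (F : flag chi) :
  exists2 g, flag_act g (std_flag chi) = F & des g \subset chi.
Proof.
pose depth x := #|[set c in chi | x \notin val F c]|.
pose key (x : 'I_n.+1) := depth x * n.+1 + x.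
have key_lt x y : depth x < depth y -> key x < key y.
  by rewrite /key => lt_d; have := ltn_ord x; nia.
have key_inj : injective key.
  move=> x y eq_key; apply: val_inj => /=.
  case: (ltngtP (depth x) (depth y)) => [/key_lt|/key_lt|eq_d].
  - by rewrite eq_key ltnn.
  - by rewrite eq_key ltnn.
  - by move: eq_key; rewrite /key eq_d => /addnI.
have key_F c x y : c \in chi -> x \in val F c -> y \notin val F c -> key x < key y.
  move=> cc xF yF; apply/key_lt/proper_card/properP; split.
    apply/subsetP=> d; rewrite !inE => /andP[dc xd]; rewrite dc.
    have [cd|dc'] := leqP c d.
      by rewrite (subsetP (flag_mono _ cc _ cd)) in xd.
    by apply: contraNN yF; apply/subsetP/flag_mono; rewrite // ltnW.
  by exists c; rewrite !inE cc ?xF ?yF.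
have [g _] := exists_ascending setT 1%g key_inj.
rewrite mulg1 => asc_g.
have gF : flag_act g (std_flag chi) = F.
  apply: flag_valE => c cc; apply/eqP; rewrite eqEcard.
  have card_F (G : flag chi) : #|val G c| = c.+1.
    by case: G => G /= /andP[/forallP/(_ c)]; rewrite cc => /eqP.
  rewrite !card_F leqnn andbT; apply/subsetP=> x; rewrite -(permKV g x).
  move: (g^-1 x)%g => p; rewrite mem_act_std_flag // => pc; apply/negPn/negP=> gpF.
  (* Every member of [F c] has a smaller key than the non-member [g p], so it sits before position
     [p]. This leaves room for at most [p] elements, fewer than [c.+1]. *)
  have : val F c \subset g @: [set q : 'I_n.+1 | q < p].
    apply/subsetP=> y yF; rewrite -(permKV g y) imset_f // inE.
    by rewrite -(ascending_setT _ _ asc_g) permKV (key_F c).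
  move/subset_leq_card; rewrite card_F card_imset; last exact: perm_inj.
  by rewrite card_ord_lt ?(ltnW (ltn_ord p)) // ltnNge pc.
(* For [i] outside [chi] no member of the flag separates the values at [lo i] and [hi i]. Their
   depths agree, and the key orders them by value. *)
exists g => //; apply/subsetP=> i; rewrite inE; apply: contraTT => ichi.
rewrite -leqNgt ltnW //.
have : key (g (lo i)) < key (g (hi i)) by rewrite (ascending_setT _ _ asc_g) loE hiE.
rewrite /key (_ : depth (g (lo i)) = depth (g (hi i))) ?ltn_add2l //.
congr #|pred_of_set _|; apply/setP=> c; rewrite !inE.
have [cc|//] := boolP (c \in chi); rewrite -gF !mem_act_std_flag // loE hiE.
have : c != i :> nat by apply: contraNneq ichi => /val_inj <-.
by case: ltngtP.
Qed.

End Flags.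

(** * A dimension argument *)

Section LinearAlgebra.
Local Open Scope ring_scope.

(** [T] is lifted through [f], on a basis, to an endomorphism [E] of [V] with [f (E v) = T v]. [E]
    is injective since [T] is, hence onto, and [f] inherits injectivity. Only [V] needs a dimension.
    The boolean form of surjectivity lets [xchoose] pick preimages. *)
Lemma surj_linear_inj (k : fieldType) (V : vectType k) (W : lmodType k)
    (T f : {linear V -> W}) :
  injective T -> (forall w, exists v, f v == w) -> injective f.
Proof.
move=> T_inj f_surj; pose b := vbasis (@fullv _ V).
pose E v := \sum_i coord b i v *: xchoose (f_surj (T b`_i)).
have EL : linear E.
  move=> a u v; rewrite /E scaler_sumr -big_split; apply: eq_bigr => i _.
  by rewrite linearP scalerDl scalerA.
have fE v : f (E v) = T v.
  rewrite {2}(coord_vbasis (memvf v)) !linear_sum; apply: eq_bigr => i _.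
  by rewrite !linearZ /= (eqP (xchooseP (f_surj _))).
pose E' := linfun (mk_linear EL).
have ker0 : lker E' == 0%VS.
  apply/lker0P=> u v; rewrite !lfunE /= => eq_E.
  by apply: T_inj; rewrite -!fE eq_E.
have onto : limg E' = fullv.
  by apply/eqP; rewrite eqEdim subvf limg_dim_eq //= (eqP ker0) capv0.
have surjE v : exists u, v = E u.
  have : v \in limg E' by rewrite onto memvf.
  by case/memv_imgP=> u _ ->; exists u; rewrite lfunE.
move=> u v; have [x ->] := surjE u; have [y ->] := surjE v.
by rewrite !fE => /T_inj ->.
Qed.

End LinearAlgebra.

(** * Products of symmetrisers and antisymmetrisers *)

Section Ribbon.
Local Open Scope ring_scope.
Variables (k : fieldType) (n : nat).
Local Notation S := 'S_n.+1.
Local Notation galg := (galg k n).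
Implicit Types (g h u v w : S) (I J K chi theta : {set 'I_n}) (x y z : galg).

Lemma gmul_eltl s x g : gmul (gelt k s) x g = x (scomp s^-1 g)%g.
Proof.
rewrite gmulE (bigD1 s) //= big1 => [|h hs]; first by rewrite ffunE eqxx mul1r addr0.
by rewrite ffunE (negbTE hs) mul0r.
Qed.

Lemma a_E K g : a_ k K g = (g \in W_ K)%:R.
Proof.
rewrite /a_ sum_ffunE; have [Wg|Wg] := boolP (g \in W_ K).
  rewrite (bigD1 g) //= big1 => [|h /andP[_ hg]]; first by rewrite ffunE eqxx addr0.
  by rewrite ffunE eq_sym (negbTE hg).
rewrite big1 // => h Wh; rewrite ffunE; case: eqP => // gh.
by rewrite gh Wh in Wg.
Qed.

Lemma b_E K g : b_ k K g = if g \in W_ K then (-1) ^+ odd_perm g else 0.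
Proof.
rewrite /b_ sum_ffunE; have [Wg|Wg] := boolP (g \in W_ K).
  rewrite (bigD1 g) //= big1 => [|h /andP[_ hg]]; last first.
    by rewrite !ffunE eq_sym (negbTE hg) scaler0.
  by rewrite !ffunE eqxx addr0 /= /GRing.scale /= mulr1.
rewrite big1 // => h Wh; rewrite !ffunE.
case: eqP => [gh|_]; last by rewrite scaler0.
by rewrite gh Wh in Wg.
Qed.

Definition young J := gmul (b_ k J) (a_ k (~: J)).

(** For [i] in [J] but not in [K], [s_ i] lies in both groups. Inserting it between the factors
    negates the first and fixes the second, so each coefficient equals its own negative. *)
Lemma b_a_eq0 J K : [pchar k] =i pred0 -> ~~ (J \subset K) ->
  gmul (b_ k J) (a_ k (~: K)) = 0.
Proof.
move=> char0 /subsetPn[i iJ iK]; apply/ffunP=> g; rewrite [RHS]ffunE.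
pose x : k := gmul (b_ k J) (a_ k (~: K)) g; have xN : x = - x.
  have WJ := s_W iJ; have WK : s_ i \in W_ (~: K) by rewrite s_W // inE.
  rewrite {1}/x gmulE (reindex_inj (mulgI (s_ i))) /x gmulE -sumrN.
  apply: eq_bigr => h _; rewrite !a_E !b_E groupMl // odd_permM odd_tperm lo_neq_hi.
  rewrite signr_addb expr1 mulN1r /scomp invMg mulgA groupMr ?groupV //.
  by case: ifP => _; rewrite ?mul0r ?oppr0 // mulNr.
apply/eqP; have /eqP := xN.
by rewrite -subr_eq0 opprK -mulr2n -mulr_natr mulf_eq0 ((pcharf0P k).1 char0) orbF.
Qed.

Lemma young_neq0 J g : young J g != 0 ->
  exists u v, [/\ u \in W_ J, v \in W_ (~: J) & g = (v * u)%g].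
Proof.
rewrite /young gmulE => nz.
have /existsP[h] : [exists h, b_ k J h * a_ k (~: J) (scomp h^-1 g)%g != 0].
  apply: contraNT nz => /existsPn nz; rewrite big1 // => h _.
  by have := nz h; rewrite negbK => /eqP.
rewrite a_E b_E; case: ifP => [Wh|_]; last by rewrite mul0r eqxx.
have [Wv _|_] := boolP (_ \in W_ (~: J)); last by rewrite mulr0 eqxx.
by exists h, (scomp h^-1 g)%g; rewrite /scomp mulgKV.
Qed.

(** The value of [young] here is the coefficient of [h] in [gelt g] times [young (des g)], by
    [gmul_eltl]. *)
Lemma young_triangular g h :
  des g = des h -> young (des g) (scomp g^-1 h)%g != 0 ->
  (moment val g <= moment val h ?= iff (g == h))%N.
Proof.
move=> eq_des /young_neq0[u [v [Wu Wv /(congr1 (mulg^~ g))]]].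
rewrite /scomp mulgKV -mulgA => hE.
have [le_m eq_m] := moment_des_triangular eq_des Wu Wv hE.
split=> //; apply/eqP/eqP=> [/eqP | -> //].
by rewrite eq_m hE => /andP[/eqP -> /eqP ->]; rewrite !mul1g.
Qed.

Lemma young_des1 g : young (des g) 1%g = 1.
Proof.
rewrite /young gmulE (bigD1 1%g) //= big1 => [|u u1].
  by rewrite a_E b_E group1 odd_perm1 /scomp invg1 mulg1 group1 mulr1 addr0.
rewrite a_E b_E /scomp mul1g; case: ifP => [Wu|_]; last by rewrite mul0r.
have [Wv|_] := boolP (_ \in W_ (~: des g)); last by rewrite mulr0.
(* Here [u] lies in both parabolic subgroups. Triangularity with [h] equal to [g] compares equal
   moments and forces [u] to be 1. *)
have gE : g = (u^-1 * (u * g))%g by rewrite mulKg.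
have [_] := moment_des_triangular (erefl (des g)) Wu Wv gE.
by rewrite eqxx (negbTE u1).
Qed.

End Ribbon.

(** * The comparison map from flag functions to sums of ribbon modules *)

Section Comparison.
Local Open Scope ring_scope.
Variables (k : fieldType) (n : nat).
Local Notation S := 'S_n.+1.
Local Notation galg := (galg k n).
Implicit Types (g h u v w : S) (I J K chi theta : {set 'I_n}) (x y z : galg).

(** Maschke averaging: [vsproj] is only a linear projection, and conjugating it by the group makes
    it equivariant. *)
Definition average J x : R_ k J :=
  (#|{: S}|%:R)^-1 *:
    \sum_g rep_act (R_ k J) g (vsproj (ribbon k J) (gmul (gelt k g^-1%g) x)).

Fact average_linear J : linear (average J).
Proof.
move=> a x y; rewrite /average scalerA [a * _]mulrC -scalerA -scalerDr; congr (_ *: _).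
rewrite scaler_sumr -big_split; apply: eq_bigr => g _ /=.
by rewrite gmul_linearr linearP; apply: R_act_linear.
Qed.

Lemma average_act J s x :
  average J (gmul (gelt k s) x) = rep_act (R_ k J) s (average J x).
Proof.
rewrite /average [RHS]linearZ [in RHS]linear_sum /=; congr (_ *: _).
rewrite (reindex_inj (mulIg s)); apply: eq_bigr => g _ /=.
rewrite -[(g * s)%g]/(scomp s g) gmulA -geltM.
rewrite (_ : scomp (scomp s g)^-1 s = g^-1)%g; last first.
  by rewrite /scomp invMg mulgA mulgV mul1g.
exact: (R_actM s g (vsproj _ _)).
Qed.

Lemma average_id J x (xJ : x \in ribbon k J) : [pchar k] =i pred0 ->
  average J x = Subvs xJ.
Proof.
move=> char0; rewrite /average (eq_bigr (fun=> Subvs xJ)) => [|g _].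
  rewrite sumr_const -scaler_nat scalerA mulVf ?scale1r //.
  by rewrite ((pcharf0P k).1 char0) -lt0n; apply/card_gt0P; exists 1%g.
apply: val_inj; rewrite /= vsprojK ?ribbon_left_ideal // gmulA -geltM.
by rewrite /scomp mulVg gmul1.
Qed.

Definition pull chi (f : M_ k chi) : galg :=
  [ffun g => (f : Mmod k chi) (flag_act g (std_flag chi))].

Fact pull_linear chi : linear (@pull chi).
Proof. by move=> a f f'; apply/ffunP=> g; rewrite !ffunE. Qed.

Lemma pull_act chi s (f : M_ k chi) :
  pull (rep_act (M_ k chi) s f) = gmul (gelt k s) (pull f).
Proof. by apply/ffunP=> g; rewrite gmul_eltl !ffunE flag_actM. Qed.

Definition push chi x : M_ k chi :=
  [ffun F => \sum_(g | flag_act g (std_flag chi) == F) x g].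

Lemma push_restrict chi theta x :
  theta \subset chi -> i_ k chi theta (push chi x) = push theta x.
Proof.
move=> tc; apply/ffunP=> F; rewrite !ffunE.
under eq_bigr do rewrite ffunE.
have forgetE g : forget theta (val (flag_act g (std_flag chi))) =
    val (flag_act g (std_flag theta)).
  apply/ffunP=> c; rewrite !ffunE; have [ct|ct] := boolP (c \in theta).
    by rewrite (subsetP tc).
  by rewrite imset0.
rewrite [RHS](partition_big (fun g => flag_act g (std_flag chi))
  (fun G : flag chi => forget theta (val G) == val F)) /=; last first.
  by move=> g /eqP <-; rewrite forgetE.
apply: eq_bigr => G /eqP GF; apply: eq_bigl => g.
apply/eqP/andP=> [E | [_ /eqP //]]; split; last exact/eqP.
by apply/eqP/val_inj; rewrite -forgetE E.
Qed.

(** The fibres of the orbit map are the left cosets of [W_ (~: chi)], and summing over them is right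
    multiplication by its symmetriser. *)
Lemma pull_push chi x : pull (push chi x) = gmul x (a_ k (~: chi)).
Proof.
apply/ffunP=> g; rewrite gmulE ffunE [LHS]ffunE big_mkcond; apply: eq_bigr => h _.
rewrite a_E eq_sym flag_act_std_eq; case: (_ \in _); first by rewrite mulr1.
by rewrite mulr0.
Qed.

Definition compare_fun chi (f : M_ k chi) : Q_ k chi :=
  dmk (fun J : {J : {set 'I_n} | J \subset chi} =>
    average (val J) (pull (i_ k chi (val J) f))).

Fact compare_linear chi : linear (@compare_fun chi).
Proof.
move=> a f f'; apply/ffunP=> J; rewrite !ffunE linearP.
by rewrite pull_linear average_linear.
Qed.

Fact compare_act chi s (f : M_ k chi) :
  mk_linear (@compare_linear chi) (rep_act _ s f) =
  rep_act _ s (mk_linear (@compare_linear chi) f).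
Proof.
by apply/ffunP=> J; rewrite !ffunE rep_hom_act pull_act average_act.
Qed.

Definition compare chi : rep_hom (M_ k chi) (Q_ k chi) := RepHom (@compare_act chi).

Lemma compareE chi f J : J \subset chi ->
  dcomp (compare chi f) J = average J (pull (i_ k chi J f)).
Proof. by move=> Jc; rewrite (dcompE _ Jc) ffunE. Qed.

Lemma compare_natural chi theta f : theta \subset chi ->
  compare theta (i_ k chi theta f) = gamma k chi theta (compare chi f).
Proof.
move=> tc; apply/ffunP=> -[J Jt]; rewrite [LHS]ffunE [RHS]ffunE /=.
rewrite compareE ?(subset_trans Jt) //; congr (average J (pull _)); exact: i_comp.
Qed.

Hypothesis char0 : [pchar k] =i pred0.

Lemma compare_push chi J x : J \subset chi ->
  dcomp (compare chi (push chi x)) J = average J (gmul x (a_ k (~: J))).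
Proof. by move=> Jc; rewrite compareE // push_restrict // pull_push. Qed.

Lemma ribbon_young J (y : R_ k J) : exists z, vsval y == gmul z (young k J).
Proof. by have /ribbonP[z ->] := subvsP y; exists z. Qed.

Lemma compare_surj chi (y : Q_ k chi) : exists f, compare chi f == y.
Proof.
(* For [m = n.+1] the vanishing condition is vacuous, and for [m = 0] it says that [y] is 0. *)
suff surj m : forall y : Q_ k chi,
    (forall J, (#|J| + m <= n)%N -> dcomp y J = 0) -> exists f, compare chi f = y.
  have [J|f <-] := surj n.+1 y; last by exists f.
  by rewrite addnS ltnNge leq_addl.
elim: m => [|m IHm] {}y y0.
  exists 0; apply/ffunP=> -[J Jc].
  rewrite linear0 [LHS]ffunE -[RHS]dcompE y0 // addn0.
  by rewrite -[X in (_ <= X)%N]card_ord max_card.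
pose z J := xchoose (ribbon_young (dcomp y J)).
have zE J : vsval (dcomp y J) = gmul (z J) (young k J).
  exact: (eqP (xchooseP (ribbon_young (dcomp y J)))).
(* [f0] cancels the components of [y] at sets of size [n - m], the smallest that may still be
   nonzero, and otherwise alters only components at larger sets. *)
pose f0 : M_ k chi :=
  \sum_(J : {set 'I_n} | (J \subset chi) && (#|J| + m == n)%N)
    push chi (gmul (z J) (b_ k J)).
have [|f fE] := IHm (y - compare chi f0); last first.
  by exists (f + f0); rewrite linearD fE subrK.
move=> K leK; have [Kc|Kc] := boolP (K \subset chi); last exact: dcomp0.
rewrite -[LHS]/(mk_linear (dcomp_linear K) (y - compare chi f0)) linearB.
rewrite /f0 linear_sum [X in _ - X]linear_sum /= => {f0}.
have push_comp J : J \subset chi -> ~~ (J \subset K) ->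
    dcomp (compare chi (push chi (gmul (z J) (b_ k J)))) K = 0.
  move=> Jc JK; rewrite compare_push // -gmulA b_a_eq0 //.
  rewrite (linear0 (mk_linear (gmul_linearr (z J))) : gmul (z J) 0 = 0).
  exact: (linear0 (mk_linear (average_linear K))).
have sub_eq J : (#|J| + m == n)%N -> J \subset K -> J = K.
  move=> /eqP cJ JK; apply/eqP; rewrite eqEcard JK; lia.
have [cK|cK] := boolP (#|K| + m == n)%N; last first.
  rewrite y0; last by lia.
  rewrite big1 ?subr0 // => J /andP[Jc cJ]; apply: push_comp => //.
  by apply: contraNN cK => /(sub_eq J cJ) <-.
rewrite (bigD1 K) ?Kc //= big1 => [|J /andP[/andP[Jc cJ] JK]]; last first.
  by apply: push_comp => //; apply: contraNN JK => /(sub_eq J cJ)/eqP.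
rewrite addr0 compare_push // -gmulA -/(young k K) -zE.
by rewrite (average_id (subvsP _) char0); apply/eqP; rewrite subr_eq0 -val_eqE.
Qed.

Lemma flag_repr_bool chi (F : flag chi) :
  exists g, (flag_act g (std_flag chi) == F) && (des g \subset chi).
Proof. by have [g /eqP gF dg] := flag_repr F; exists g; rewrite gF. Qed.

Definition flag_rep chi (F : flag chi) : S := xchoose (flag_repr_bool F).

Lemma flag_rep_inj chi : injective (@flag_rep chi).
Proof.
move=> F G eqFG; have /andP[/eqP <- _] := xchooseP (flag_repr_bool F).
have /andP[/eqP <- _] := xchooseP (flag_repr_bool G).
by rewrite -!/(flag_rep _) eqFG.
Qed.

Lemma des_flag_rep chi (F : flag chi) : des (flag_rep F) \subset chi.
Proof. by case/andP: (xchooseP (flag_repr_bool F)). Qed.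

(** The indicator of a flag with representative [w] goes to [w] times the generator, in the single
    component [des w]. The map serves only as the injective linear map in the dimension argument;
    [vsproj] merely packages an element already in the ribbon module. *)
Definition flag_ribbon_fun chi (f : M_ k chi) : Q_ k chi :=
  dmk (V := @R_ k n) (fun J : {J : {set 'I_n} | J \subset chi} =>
    \sum_(F | des (flag_rep F) == val J)
      (f : Mmod k chi) F *: (vsproj (ribbon k (val J))
        (gmul (gelt k (flag_rep F)) (young k (val J))) : R_ k (val J))).

Fact flag_ribbon_linear chi : linear (@flag_ribbon_fun chi).
Proof.
move=> a f f'; apply/ffunP=> J; rewrite !ffunE scaler_sumr -big_split.
by apply: eq_bigr => F _; rewrite !ffunE scalerDl scalerA.
Qed.

Lemma flag_ribbon_coef chi (f : M_ k chi) J w : J \subset chi ->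
  vsval (dcomp (flag_ribbon_fun f) J) w = \sum_(F : flag chi | des (flag_rep F) == J)
    (f : Mmod k chi) F * young k J (scomp (flag_rep F)^-1 w)%g.
Proof.
move=> Jc; rewrite (dcompE _ Jc) ffunE linear_sum sum_ffunE; apply: eq_bigr => F _.
rewrite linearZ ffunE /= vsprojK ?gmul_eltl //.
by apply/ribbonP; exists (gelt k (flag_rep F)).
Qed.

(** In the support of [f], take [F] whose representative has the least moment, and read off the
    coefficient at that representative. By triangularity another flag could contribute only with a
    smaller moment. *)
Lemma flag_ribbon_inj chi : injective (mk_linear (@flag_ribbon_linear chi)).
Proof.
apply/raddf_inj => f sf0; apply/eqP; apply: contraT => f_nz.
have [F0 nzF0] : exists F, (f : Mmod k chi) F != 0.
  apply/existsP; apply: contraNT f_nz => /existsPn f0.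
  by apply/eqP/ffunP=> F; have := f0 F; rewrite negbK ffunE => /eqP.
have [F nzF minF] := @arg_minnP _ F0 (fun F => (f : Mmod k chi) F != 0)
  (fun F => moment val (flag_rep F)) nzF0.
have := flag_ribbon_coef f (flag_rep F) (des_flag_rep F).
have -> : dcomp (flag_ribbon_fun f) (des (flag_rep F)) = 0.
  by rewrite [flag_ribbon_fun f]sf0; exact: (linear0 (mk_linear (dcomp_linear _))).
rewrite (bigD1 F) //= big1 => [|G /andP[/eqP dG GF]].
  rewrite ffunE /scomp mulgV young_des1 mulr1 addr0 => fF0.
  by rewrite -fF0 eqxx in nzF.
apply/eqP; rewrite mulf_eq0; apply/norP=> -[fG yG].
rewrite -dG in yG.
have [leGF eqGF] := young_triangular dG yG.
move/negP: GF; apply.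
by rewrite -(inj_eq (@flag_rep_inj chi)) -eqGF eqn_leq leGF minF.
Qed.

Lemma compare_inj chi : injective (compare chi).
Proof.
exact: (@surj_linear_inj k {ffun flag chi -> k^o} (Q_ k chi)
  (mk_linear (@flag_ribbon_linear chi)) (compare chi) (@flag_ribbon_inj chi)
  (@compare_surj chi)).
Qed.

End Comparison.

(** * From isomorphic cubes with opposite signs to isomorphic complexes *)

Section CubeIso.
Local Open Scope ring_scope.
Variables (k : fieldType) (m n : nat) (V W : cube k m n).
Variables (eps eta : {set 'I_n} -> 'I_n -> k).
Hypotheses (epsP : sign_rule eps) (etaP : sign_rule eta).
Hypothesis eps_eta : forall (I : {set 'I_n}) j, j \notin I -> eps I j = - eta I j.
Variable f : forall I : {set 'I_n}, rep_hom (V I) (W I).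
Hypothesis f_natural : forall (I J : {set 'I_n}) x, I \subset J ->
  f I (cube_map V J I x) = cube_map W J I (f J x).
Hypothesis f_inj : forall I, injective (f I).
Hypothesis f_surj : forall I y, exists x, f I x == y.

(** The factor [(-1) ^+ i] alternates with the degree and so absorbs the global sign between the two
    differentials. *)
Definition cube_iso_fun i (x : cube_term V i) : cube_term W i :=
  dmk (V := W) (fun I : {I : {set 'I_n} | (#|I| + i == n)%N} =>
    (-1) ^+ i *: f (val I) ((x : dsum_mod _ V) I)).

Fact cube_iso_linear i : linear (@cube_iso_fun i).
Proof.
move=> a x y; apply/ffunP=> I.
by rewrite !ffunE linearP scalerDr !scalerA mulrC.
Qed.

Fact cube_iso_act i s (x : cube_term V i) :
  mk_linear (@cube_iso_linear i) (rep_act _ s x) =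
  rep_act _ s (mk_linear (@cube_iso_linear i) x).
Proof. by apply/ffunP=> I; rewrite !ffunE rep_hom_act linearZ. Qed.

Lemma dcomp_cube_iso i (x : cube_term V i) I :
  dcomp (cube_iso_fun x) I = (-1) ^+ i *: f I (dcomp x I).
Proof.
have [cI|cI] := boolP (#|I| + i == n)%N; last by rewrite !dcomp0 // linear0 scaler0.
by rewrite !(dcompE _ cI) ffunE.
Qed.

Lemma cube_complex_iso : complex_iso (cube_complex V epsP) (cube_complex W etaP).
Proof.
exists (fun i => RepHom (@cube_iso_act i)); split=> [i|i x]; last first.
  apply/ffunP=> -[I cI]; rewrite !ffunE /= linear_sum scaler_sumr.
  apply: eq_bigr => j jI; rewrite dcomp_cube_iso !linearZ /= f_natural ?subsetUr //.
  by rewrite eps_eta // !scalerA exprS mulN1r mulrNN mulrC.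
(* A set-theoretic inverse suffices for [bijective], so preimages are chosen componentwise. The same
   sign reappears because it squares to 1. *)
pose g (y : cube_term W i) : cube_term V i :=
  dmk (V := V) (fun I : {I : {set 'I_n} | (#|I| + i == n)%N} =>
    xchoose (f_surj ((-1) ^+ i *: (y : dsum_mod _ W) I))).
exists g => x; apply/ffunP=> I; rewrite !ffunE.
  apply: f_inj; rewrite (eqP (xchooseP (f_surj _))).
  by rewrite scalerA -expr2 sqrr_sign scale1r.
by rewrite (eqP (xchooseP (f_surj _))) scalerA -expr2 sqrr_sign scale1r.
Qed.

End CubeIso.

(** The 1-based position of [c] counts [c] itself, one more than the number of smaller members of
    [A]. *)
Lemma Mas_signE (k : fieldType) n (A : {set 'I_n}) c : c \notin A ->
  Mas_sign k A c = (- Phi_sign k A c)%R.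
Proof.
move=> cA; rewrite /Mas_sign /Phi_sign.
rewrite (_ : [set d in c |: A | (d <= c)%N] = c |: [set d in A | (d < c)%N]).
  by rewrite cardsU1 !inE (negbTE cA) /= exprS mulN1r.
apply/setP=> d; rewrite !inE leq_eqVlt val_eqE.
by case: (eqVneq d c) => [-> | dc] //=; rewrite ?eqxx.
Qed.

Theorem theorem4p7p1 (k : fieldType) (k_char0 : ([pchar k] =i pred0)%R)
    (n : nat) (n_ge1 : 0 < n) :
  complex_iso (Mas k n) (PhiQ k n).
Proof.
apply: (@cube_complex_iso _ _ _ (M_cube k n) (Q_cube k n)
  _ _ _ _ _ (@compare k n)).
- by move=> I j; exact: Mas_signE.
- by move=> I J x IJ; exact: compare_natural.
- exact: compare_inj.
- exact: compare_surj.
Qed.
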